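(* Fix $L>0$. For each $\beta>0$ let $$A_{2,L,\beta}:=\Big\{b\in L^1_{\rm loc}(\mathbb{R})\ \Big|\ b(\cdot+L)=b(\cdot),\ b\ge 0,\ \frac1L\int_0^L b^2\,dx=\beta\Big\}$$ and let $b_\beta\in A_{2,L,\beta}$ satisfy $c^*(b_\beta)=\max_{b\in A_{2,L,\beta}}c^*(b)$. Then for any $k\in\mathbb{N}$, $$\big\|b_\beta-\sqrt{\beta}\big\|_{C^2}=O(\beta^k)\quad\text{as } \beta\to0.$$
   Context: For $\lambda\in\mathbb{R}$ and a real $L$-periodic function $b\in L^1_{\rm loc}(\mathbb{R})$, $k(\lambda,b)\in\mathbb{R}$ denotes the principal eigenvalue of $-L_{\lambda,b}\psi:=-\psi''-2\lambda\psi'-(b(x)+\lambda^2)\psi$ on $\mathbb{R}/L\mathbb{Z}$, i.e. the unique real number for which $-L_{\lambda,b}\psi=k(\lambda,b)\psi$ has an $L$-periodic positive solution $\psi$. For $b\ge0$, $b\not\equiv0$, the minimal speed of pulsating traveling waves of $u_t=u_{xx}+b(x)(1-u)u$ is $c^*(b)=\min_{\lambda>0}\frac{-k(\lambda,b)}{\lambda}$. Functions are identified when equal almost everywhere; $\|w\|_{C^2}=\|w\|_{L^\infty}+\|w'\|_{L^\infty}+\|w''\|_{L^\infty}$. *)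

(* Defs.v *)
From HB Require Import structures.
From mathcomp Require Import all_boot all_order all_algebra.
From mathcomp Require Import all_classical all_reals all_analysis.

Set Implicit Arguments.
Unset Strict Implicit.
Unset Printing Implicit Defensive.

Import Order.TTheory GRing.Theory Num.Theory.
Import numFieldNormedType.Exports.

Local Open Scope classical_set_scope.
Local Open Scope ring_scope.

Section defs.
Context {R : realType}.
Implicit Types (L lambda beta : R) (b f : R -> R).

Local Notation mu := (@lebesgue_measure R).

(* F is locally absolutely continuous with a.e. derivative f in L^1_loc. *)
Definition has_L1loc_derivative (F f : R -> R) : Prop :=
  locally_integrable [set: R] f /\
  forall x y, x <= y -> F y - F x = \int[mu]_(t in `[x, y]) f t.

(* As b is only in L^1_loc, solutions are understood in W^{2,1}_loc: psi is
   differentiable, psi' is locally absolutely continuous with a.e. derivative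
   psi2, and the equation holds almost everywhere. *)
Definition positive_periodic_solution L lambda b (k : R) (psi : R -> R) : Prop :=
  [/\ forall x, psi (x + L) = psi x,
      forall x, 0 < psi x,
      forall x, derivable psi x 1 &
      exists psi2 : R -> R, has_L1loc_derivative (derive1 psi) psi2 /\
        {ae mu, forall x, - psi2 x - 2 * lambda * derive1 psi x
                          - (b x + lambda ^+ 2) * psi x = k * psi x}].

(* The value 0 when no such k exists is a mere totality convention: for
   L-periodic b in L^1_loc there is exactly one such k. *)
Definition principal_eigenvalue L lambda b : R :=
  xget 0 [set k | exists psi, positive_periodic_solution L lambda b k psi].

(* Minimum (not infimum) over lambda > 0; it is attained for b >= 0, b <> 0, and
   0 is again a totality convention. *)
Definition minimal_speed L b : R :=
  let speed lambda := - principal_eigenvalue L lambda b / lambda in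
  xget 0 [set c | (exists2 lambda, 0 < lambda & c = speed lambda) /\
                  forall lambda, 0 < lambda -> c <= speed lambda].

Definition A2 L beta : set (R -> R) :=
  [set b | [/\ locally_integrable [set: R] b,
               {ae mu, forall x, b (x + L) = b x},
               {ae mu, forall x, 0 <= b x} &
               (L^-1%:E * \int[mu]_(x in `[0%R, L]) (b x ^+ 2)%:E = beta%:E)%E]].

Definition maximizes_speed L beta b : Prop :=
  A2 L beta b /\ forall a, A2 L beta a -> minimal_speed L a <= minimal_speed L b.

Definition is_C2 f : Prop :=
  [/\ forall x, derivable f x 1, forall x, derivable (derive1 f) x 1 &
      continuous (derive1n 2 f)].

(* The C^2 norm of the a.e.-class of f: that of its C^2 representative (unique
   when it exists), and +oo when there is none. *)
Definition C2norm f : \bar R :=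
  ereal_inf [set ('N[mu]_+oo[EFin \o g] + 'N[mu]_+oo[EFin \o derive1 g]
                  + 'N[mu]_+oo[EFin \o derive1n 2 g])%E
            | g in [set g | is_C2 g /\ {ae mu, forall x, f x = g x}]].

End defs.

(* Main.v *)
(* For beta < (2 L^2)^-2 a maximizer is exactly sqrt beta almost everywhere.
   Let psi be a periodic positive solution with eigenvalue k, m the mean of b,
   c = - k - lambda^2 and v = psi'/psi. Then v is periodic with mean 0 and
   v' + v^2 + 2 lambda v + b = c. Multiplying by v' and integrating kills the
   terms v v' and v^2 v', whence |v'|_2 <= |b - m|_2 for the L^2 norms on
   [0, L]. As v vanishes somewhere, sup |v| <= int |v'|, and integrating the
   equation gives m <= c <= m + L^2 (beta - m^2), uniformly in lambda.
   With s = sqrt beta, the constant s has minimal speed 2 sqrt s, so at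
   lambda = sqrt s a maximizer satisfies 2 s <= - k, that is,
   s - m <= L^2 (s - m) (s + m). For small beta this forces m = s, and then
   b - m has zero L^2 norm. *)
Require Import Defs.
From HB Require Import structures.
From mathcomp Require Import all_boot all_order all_algebra.
From mathcomp Require Import all_classical all_reals all_analysis.
From mathcomp Require Import measurable_realfun.
From mathcomp Require Import ring lra.

Set Implicit Arguments.
Unset Strict Implicit.
Unset Printing Implicit Defensive.

Import Order.TTheory GRing.Theory Num.Theory.
Import numFieldNormedType.Exports.

Local Open Scope classical_set_scope.
Local Open Scope ring_scope.

(** * Integrals of real-valued functions over segments *)

Section integrable_real.
Context {R : realType}.
Local Notation mu := (@lebesgue_measure R).
Implicit Types (D : set R) (f g : R -> R).

Lemma integrable_funD D f g : measurable D ->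
  mu.-integrable D (EFin \o f) -> mu.-integrable D (EFin \o g) ->
  mu.-integrable D (EFin \o (fun x => f x + g x)).
Proof. by move=> mD fi gi; have := @integrableD _ _ _ mu _ mD _ _ fi gi. Qed.

Lemma integrable_funB D f g : measurable D ->
  mu.-integrable D (EFin \o f) -> mu.-integrable D (EFin \o g) ->
  mu.-integrable D (EFin \o (fun x => f x - g x)).
Proof. by move=> mD fi gi; have := @integrableB _ _ _ mu _ mD _ _ fi gi. Qed.

Lemma integrable_funZ D f (k : R) : measurable D ->
  mu.-integrable D (EFin \o f) ->
  mu.-integrable D (EFin \o (fun x => k * f x)).
Proof. by move=> mD fi; have := @integrableZl _ _ _ mu _ mD k _ fi. Qed.

(** A continuous factor is bounded on the compact segment, so it preserves integrability. *)
Lemma integrable_mul_continuous (a b : R) f g :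
  mu.-integrable `[a, b] (EFin \o f) -> {within `[a, b], continuous g} ->
  mu.-integrable `[a, b] (EFin \o (fun x => f x * g x)).
Proof.
move=> fi cg; have mD : measurable (`[a, b] : set R) by exact: measurable_itv.
have := @integrableMl _ _ _ mu _ mD _ _ fi (subspace_continuous_measurable_fun mD cg); apply.
have [M [Mreal mrt]] := compact_bounded (continuous_compact cg (@segment_compact _ a b)).
by exists M; split => // N MN x abx; apply: mrt MN _ _; exists x.
Qed.

Lemma integrable_cst_itv (a b k : R) :
  mu.-integrable `[a, b] (EFin \o (fun=> k)).
Proof.
apply: continuous_compact_integrable; first exact: segment_compact.
by move=> x; exact: cvg_cst.
Qed.

Lemma Rintegral_itv_cst (L s : R) : 0 < L -> \int[mu]_(x in `[0, L]) s = s * L.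
Proof.
move=> L0; rewrite Rintegral_cst//; congr (_ * _).
transitivity (fine (mu `[0, L]%classic)) => //.
by rewrite lebesgue_measure_itv/= lte_fin L0 -EFinD subr0.
Qed.

Lemma ae_eq_Rintegral D f g : measurable D ->
  mu.-integrable D (EFin \o f) -> mu.-integrable D (EFin \o g) ->
  {ae mu, forall x, f x = g x} ->
  \int[mu]_(x in D) f x = \int[mu]_(x in D) g x.
Proof.
move=> mD fi gi fg; rewrite /Rintegral; congr fine.
apply: ae_eq_integral => //; [exact: measurable_int fi|exact: measurable_int gi|].
by apply: filterS fg; [exact: (ae_filter_ringOfSetsType mu)|move=> x /= ->].
Qed.

Lemma Rintegral_cat f (x y z : R) : x <= y -> y <= z ->
  mu.-integrable `[x, z] (EFin \o f) ->
  \int[mu]_(t in `[x, z]) f t =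
  \int[mu]_(t in `[x, y]) f t + \int[mu]_(t in `[y, z]) f t.
Proof.
move=> xy yz fi; apply/eqP; rewrite addrC -subr_eq; apply/eqP.
rewrite Rintegral_itvB ?bnd_simp// Rintegral_itv_obnd_cbnd//.
by apply: integrableS fi => //; apply: subset_itvScc; rewrite bnd_simp.
Qed.

End integrable_real.

(** * Absolutely continuous functions in integral form and their product rule *)

Section antiderivative.
Context {R : realType}.
Local Notation mu := (@lebesgue_measure R).
Implicit Types (a b x y t u : R) (F G f g : R -> R).

(** Increments that are quadratic in those of a continuous function add up to nothing under
    refinement. In the product rule this replaces differentiation almost everywhere. *)
Lemma eq_of_quadratic_increments a b (H Phi : R -> R) :
  {within `[a, b], continuous Phi} ->
  (forall x y, a <= x -> x <= y -> y <= b ->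
    `|H y - H x| <= (Phi y - Phi x) ^+ 2) ->
  a <= b -> H b = H a.
Proof.
move=> cPhi quad ab.
(* Splitting where Phi takes its midpoint value halves the quadratic bound. *)
have halve n x y : a <= x -> x <= y -> y <= b ->
    `|H y - H x| * 2 ^+ n <= (Phi y - Phi x) ^+ 2.
  elim: n x y => [|n IH] x y ax xy yb; first by rewrite mulr1 quad.
  have cPhixy : {within `[x, y], continuous Phi}.
    by apply: continuous_subspaceW cPhi; apply: subset_itvScc; rewrite bnd_simp.
  have mid : Num.min (Phi x) (Phi y) <= (Phi x + Phi y) / 2 <= Num.max (Phi x) (Phi y).
    rewrite minEle maxEle; case: (leP (Phi x) (Phi y)) => h;
      by apply/andP; split; lra.
  have [c] := IVT xy cPhixy mid.
  rewrite in_itv/= => /andP[xc cy] Phic.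
  have := IH x c ax xc (le_trans cy yb); have := IH c y (le_trans ax xc) cy yb.
  rewrite Phic => h1 h2; rewrite exprS.
  have : `|H y - H x| <= `|H y - H c| + `|H c - H x|.
    by rewrite (le_trans _ (ler_normD _ _))// addrA subrK.
  have : 0 < 2 ^+ n :> R by rewrite exprn_gt0.
  nra.
apply/eqP; rewrite -subr_eq0 -normr_eq0 eq_le normr_ge0 andbT leNgt.
apply/negP => e0; set e := `|H b - H a| in e0.
(* If [e > 0], some [n] exceeds [(Phi b - Phi a)^2 / e]; as [n < 2^n], this contradicts [halve] on
   the whole segment. *)
have := @archi_boundP R ((Phi b - Phi a) ^+ 2 / e).
rewrite divr_ge0 ?sqr_ge0 ?(ltW e0)// => /(_ isT); set n := Num.bound _.
rewrite ltr_pdivrMr// mulrC; apply/negP; rewrite -leNgt.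
rewrite (le_trans _ (halve n a b (lexx _) ab (lexx _)))//.
by rewrite ler_pM2l// -natrX ler_nat ltnW// ltn_expl.
Qed.

(** Absolute continuity on a segment with density [f], in integral form: pointwise derivatives would
    exist only almost everywhere. *)
Definition antiderivative a b F f : Prop :=
  mu.-integrable `[a, b] (EFin \o f) /\
  forall x y, a <= x -> x <= y -> y <= b ->
    F y - F x = \int[mu]_(t in `[x, y]) f t.

Lemma integrable_subitv a b x y f : a <= x -> y <= b ->
  mu.-integrable `[a, b] (EFin \o f) -> mu.-integrable `[x, y] (EFin \o f).
Proof.
by move=> ax yb; apply: integrableS => //; apply: subset_itvScc; rewrite bnd_simp.
Qed.

Lemma antiderivative_continuous a b F f : a <= b -> antiderivative a b F f ->
  {within `[a, b], continuous F}.
Proof.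
move=> ab [fi Ff].
have cI := parameterized_integral_continuous ab fi.
have : {within `[a, b], continuous (fun x => F a + \int[mu]_(t in `[a, x]) f t)}.
  by move=> x; apply: cvgD; [exact: cvg_cst|exact: cI].
apply: subspace_eq_continuous => x; rewrite inE/= in_itv/= => /andP[ax xb].
by rewrite /from_subspace -Ff// addrC subrK.
Qed.

(** One bound over [[x, y]] serves all inner increments at once. It is used in the product rule and
    for the sup bound on [v]. *)
Lemma antiderivative_dist_le a b F f g x y t u :
  antiderivative a b F f -> mu.-integrable `[a, b] (EFin \o g) ->
  (forall s, `|f s| <= g s) ->
  a <= x -> x <= t -> t <= u -> u <= y -> y <= b ->
  `|F u - F t| <= \int[mu]_(s in `[x, y]) g s.
Proof.
move=> [fi Ff] gi fg ax xt tu uy yb.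
have at_ := le_trans ax xt; have ub := le_trans uy yb.
rewrite Ff//; apply: le_trans (le_normr_Rintegral _ _) _ => //.
  exact: integrable_subitv fi.
apply: (@le_trans _ _ (\int[mu]_(s in `[t, u]) g s)).
  apply: le_Rintegral => //.
  - exact/integrable_norm/(integrable_subitv at_ ub).
  - exact: integrable_subitv gi.
have g0 z w : 0 <= \int[mu]_(s in `[z, w]) g s.
  by apply: Rintegral_ge0 => s _; exact: le_trans (fg s).
rewrite (@Rintegral_cat _ _ x t y)//; [|exact: le_trans uy|exact: integrable_subitv gi].
rewrite (@Rintegral_cat _ _ t u y)//; last exact: integrable_subitv gi.
by rewrite addrCA lerDl addr_ge0.
Qed.

(* With Phi an antiderivative of |f| + |g|, the increment of
   F G - int (f G + g F) over [x, y] is at most (Phi y - Phi x) ^+ 2. *)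
Lemma antiderivativeM a b F G f g : a <= b ->
  antiderivative a b F f -> antiderivative a b G g ->
  antiderivative a b (fun x => F x * G x) (fun x => f x * G x + g x * F x).
Proof.
move=> ab AF AG; have cF := antiderivative_continuous ab AF.
have cG := antiderivative_continuous ab AG.
have [fi Ff] := AF; have [gi Gg] := AG.
have mab x y : measurable (`[x, y] : set R) by exact: measurable_itv.
have fGi := integrable_mul_continuous fi cG.
have gFi := integrable_mul_continuous gi cF.
have hi := integrable_funD (mab a b) fGi gFi.
split => // x y ax xy yb.
pose p t := `|f t| + `|g t|.
have pi : mu.-integrable `[a, b] (EFin \o p).
  by apply: integrable_funD => //; exact: integrable_norm.
pose h t := f t * G t + g t * F t.
pose H z := F z * G z - \int[mu]_(t in `[a, z]) h t.
pose Phi z := \int[mu]_(t in `[a, z]) p t.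
suff : H y = H x.
  rewrite /H (@Rintegral_cat _ h a x y)//; last exact: integrable_subitv hi.
  by rewrite -/h; lra.
apply: (@eq_of_quadratic_increments x y H Phi) => //.
  have cPhi := parameterized_integral_continuous ab pi.
  by apply: continuous_subspaceW cPhi; apply: subset_itvScc; rewrite bnd_simp.
move=> {}x' {}y' xx' xy' yy'.
have {xx' ax} ax : a <= x' by exact: le_trans xx'.
have {yy' yb} yb : y' <= b by exact: le_trans yb.
rewrite /H /Phi (@Rintegral_cat _ h a x' y')//; last exact: integrable_subitv hi.
rewrite (@Rintegral_cat _ p a x' y')//; last exact: integrable_subitv pi.
(* The increment of [F G] is split with [G] frozen at [x'] and [F] at [y'], so both pieces become
   integrals of [f] and [g] times constants. *)
have -> : F y' * G y' - (\int[mu]_(t in `[a, x']) h t + \int[mu]_(t in `[x', y']) h t)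
    - (F x' * G x' - \int[mu]_(t in `[a, x']) h t)
  = (F y' - F x') * G x' + (G y' - G x') * F y' - \int[mu]_(t in `[x', y']) h t.
  ring.
rewrite (addrC (\int[mu]_(t in `[a, x']) p t)) addrK.
have sub k : mu.-integrable `[a, b] (EFin \o k) ->
    mu.-integrable `[x', y'] (EFin \o k) by exact: integrable_subitv.
set D := \int[mu]_(t in `[x', y']) p t.
rewrite Ff// Gg// -!RintegralZr//; [|exact: sub..].
have fci c : mu.-integrable `[a, b] (EFin \o (fun t => f t * c)).
  by apply: integrable_mul_continuous => // z; exact: cvg_cst.
have gci c : mu.-integrable `[a, b] (EFin \o (fun t => g t * c)).
  by apply: integrable_mul_continuous => // z; exact: cvg_cst.
rewrite -RintegralD//; [|exact: sub..].
have i1 := integrable_funD (mab a b) (fci (G x')) (gci (F y')).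
rewrite -RintegralB//; [|exact: sub..].
apply: le_trans (le_normr_Rintegral _ _) _ => //.
  by apply: sub; exact: integrable_funB.
rewrite expr2 -RintegralZl//; last exact: sub.
apply: le_Rintegral => //.
- by apply/integrable_norm/sub; exact: integrable_funB.
- by apply: sub; exact: integrable_funZ.
move=> t; rewrite /= in_itv/= => /andP[xt ty].
have dG : `|G t - G x'| <= D.
  by apply: antiderivative_dist_le AG pi _ _ _ _ _ _ => // s; rewrite lerDr.
have dF : `|F y' - F t| <= D.
  by apply: antiderivative_dist_le AF pi _ _ _ _ _ _ => // s; rewrite lerDl.
(* Both differences are at most [D] in absolute value, so the integrand is at most [D * p t] and its
   integral at most [D^2]. *)
rewrite (_ : _ - _ = g t * (F y' - F t) - f t * (G t - G x')); last by rewrite /h; ring.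
apply: le_trans (ler_normB _ _) _; rewrite !normrM /p.
have := normr_ge0 (f t); have := normr_ge0 (g t); nra.
Qed.

Lemma derivable_antiderivative a b F f : (forall x, is_derive x 1 F (f x)) ->
  continuous f -> antiderivative a b F f.
Proof.
move=> dF cf.
have cF : continuous F.
  by move=> x; apply: differentiable_continuous; apply/derivable1_diffP; case: (dF x).
split.
  apply: continuous_compact_integrable; first exact: segment_compact.
  exact: continuous_subspaceT.
move=> x y _ + _; rewrite le_eqVlt => /predU1P[->|xy].
  by rewrite set_itv1 Rintegral_set1 subrr.
rewrite /Rintegral (@continuous_FTC2 _ f F)//.
- exact: continuous_subspaceT.
- split; first by move=> z _; case: (dF z).
  + exact/cvg_at_right_filter/cF.
  + exact/cvg_at_left_filter/cF.
- by move=> z _; rewrite derive1E; case: (dF z).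
Qed.

Lemma ae_eq_antiderivative a b F f g : {ae mu, forall x, f x = g x} ->
  mu.-integrable `[a, b] (EFin \o g) ->
  antiderivative a b F f -> antiderivative a b F g.
Proof.
move=> fg gi [fi Ff]; split => // x y ax xy yb; rewrite Ff//.
apply: ae_eq_Rintegral => //.
- exact: integrable_subitv fi.
- exact: integrable_subitv gi.
Qed.

End antiderivative.

(** * Integral estimates for the Riccati equation *)

Section riccati.
Context {R : realType}.
Local Notation mu := (@lebesgue_measure R).

Local Ltac solve_integrable := repeat first
  [ assumption | exact: measurable_itv | exact: integrable_cst_itv
  | apply: integrable_funB | apply: integrable_funD | apply: integrable_funZ ].

(** Here [r] plays the role of [v']. Up to constants, [r], [r v] and [r v^2] are derivatives of
    powers of [v], which agree at both ends; their integrals vanish, and [lambda] drops out of the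
    estimates. *)
Lemma riccati_bounds (L lambda c : R) (b v : R -> R) : 0 < L ->
  let r x := c - b x - v x ^+ 2 - 2 * lambda * v x in
  let m := L^-1 * \int[mu]_(x in `[0, L]) b x in
  let q := L^-1 * \int[mu]_(x in `[0, L]) (b x ^+ 2) in
  mu.-integrable `[0, L] (EFin \o b) ->
  mu.-integrable `[0, L] (EFin \o (fun x => b x ^+ 2)) ->
  antiderivative 0 L v r -> v 0 = v L ->
  \int[mu]_(x in `[0, L]) v x = 0 ->
  (exists2 x0 : R, x0 \in `[0, L] & v x0 = 0) ->
  m <= c <= m + L ^+ 2 * (q - m ^+ 2).
Proof.
move=> L0 r m q bi b2i vr vL Iv0 [x0 x0L vx0].
have L0' := ltW L0.
have rE x : r x = c - b x - v x ^+ 2 - 2 * lambda * v x by [].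
clearbody r.
have cv := antiderivative_continuous L0' vr.
have v2r := antiderivativeM L0' vr vr.
have v3r := antiderivativeM L0' v2r vr.
have [ri vrE] := vr.
have vi : mu.-integrable `[0, L] (EFin \o v).
  by apply: continuous_compact_integrable => //; exact: segment_compact.
have cv2 : {within `[0, L], continuous (fun x => v x * v x)}.
  exact: antiderivative_continuous L0' v2r.
have v2i : mu.-integrable `[0, L] (EFin \o (fun x => v x * v x)).
  by apply: continuous_compact_integrable => //; exact: segment_compact.
have rvi := integrable_mul_continuous ri cv.
have rv2i := integrable_mul_continuous ri cv2.
have bvi := integrable_mul_continuous bi cv.
have bv2i := integrable_mul_continuous bi cv2.
have Icst (k : R) := Rintegral_itv_cst k L0.
have mI : measurable (`[0, L] : set R) by exact: measurable_itv.
have Ir : \int[mu]_(x in `[0, L]) r x = 0 by rewrite -vrE// vL subrr.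
have Irv : \int[mu]_(x in `[0, L]) (r x * v x) = 0.
  have [_ /(_ 0 L (lexx _) L0' (lexx _))] := v2r.
  by rewrite vL subrr RintegralD//; lra.
have Irv2 : \int[mu]_(x in `[0, L]) (r x * (v x * v x)) = 0.
  have [_ /(_ 0 L (lexx _) L0' (lexx _))] := v3r.
  rewrite vL subrr.
  under eq_Rintegral => x _.
    rewrite (_ : (r x * v x + r x * v x) * v x + r x * (v x * v x)
             = 3 * (r x * (v x * v x))); last by ring.
    over.
  by rewrite RintegralZl//; lra.
have Im : \int[mu]_(x in `[0, L]) b x = m * L.
  by rewrite /m mulrC mulrA divff ?mul1r// gt_eqF.
have Iq : \int[mu]_(x in `[0, L]) (b x ^+ 2) = q * L.
  by rewrite /q mulrC mulrA divff ?mul1r// gt_eqF.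
clearbody m q.
set V := \int[mu]_(x in `[0, L]) (v x * v x).
(* Integrating the equation shows that [c - m] is the mean of [v^2]. The lower bound is then
   immediate, and the rest bounds [V]. *)
have cE : c * L = m * L + V.
  move: Ir; under eq_Rintegral do rewrite rE expr2.
  rewrite !RintegralB ?RintegralZl//; solve_integrable.
  by rewrite Icst Im Iv0 -/V; lra.
have V0 : 0 <= V by apply: Rintegral_ge0 => x _; rewrite -expr2 sqr_ge0.
(* A product of two integrable functions need not be integrable; expanding [r] leaves [b^2],
   integrable by hypothesis, and products of [b] with continuous functions. *)
have rbi : mu.-integrable `[0, L] (EFin \o (fun x => r x * b x)).
  have -> : (fun x => r x * b x) =
      (fun x => c * b x - b x ^+ 2 - b x * (v x * v x) - 2 * lambda * (b x * v x)).
    by apply/funext => x; rewrite rE; ring.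
  solve_integrable.
set S := \int[mu]_(x in `[0, L]) (r x * b x).
(* Only one of the two factors [r] is expanded, so that the integral of [r^2] reduces to [- S] by
   the vanishing integrals. *)
have r2E x : r x ^+ 2 =
    c * r x - r x * (v x * v x) - 2 * lambda * (r x * v x) - r x * b x.
  by rewrite expr2 {1}rE; ring.
have r2i : mu.-integrable `[0, L] (EFin \o (fun x => r x ^+ 2)).
  under [fun x => r x ^+ 2]funext do rewrite r2E.
  solve_integrable.
have Ir2 : \int[mu]_(x in `[0, L]) (r x ^+ 2) = - S.
  under eq_Rintegral do rewrite r2E.
  rewrite !RintegralB ?RintegralZl//; solve_integrable.
  by rewrite Ir Irv Irv2 -/S; ring.
(* The square of [r + (b - m)] integrates to [S + (q - m^2) L]; hence the integral of [r^2] is at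
   most that of [(b - m)^2]. *)
have S_ub : - S <= (q - m ^+ 2) * L.
  have : 0 <= \int[mu]_(x in `[0, L]) (r x + (b x - m)) ^+ 2.
    by apply: Rintegral_ge0 => x _; exact: sqr_ge0.
  under eq_Rintegral => x _.
    rewrite (_ : (r x + (b x - m)) ^+ 2 = r x ^+ 2 + 2 * (r x * b x)
      - 2 * m * r x + b x ^+ 2 - 2 * m * b x + m ^+ 2); last by ring.
    over.
  rewrite !(RintegralB, RintegralD) ?RintegralZl//; solve_integrable.
  by rewrite Ir2 Ir Im Iq Icst -/S; lra.
have ari := integrable_norm ri.
set N := \int[mu]_(x in `[0, L]) `|r x|.
(* Cauchy-Schwarz for [|r|] and 1, read off from the variance of [|r|]. *)
have N_ub : N ^+ 2 <= - S * L.
  have : 0 <= \int[mu]_(x in `[0, L]) (`|r x| * L - N) ^+ 2.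
    by apply: Rintegral_ge0 => x _; exact: sqr_ge0.
  under eq_Rintegral => x _.
    rewrite (_ : (`|r x| * L - N) ^+ 2 =
      L ^+ 2 * r x ^+ 2 - 2 * L * N * `|r x| + N ^+ 2); last by
      rewrite -(real_normK (num_real (r x))); ring.
    over.
  rewrite !(RintegralB, RintegralD) ?RintegralZl//; solve_integrable.
  rewrite Ir2 Icst -/N => h.
  by rewrite -(ler_pM2r L0); lra.
have v_ub x : x \in `[0, L] -> `|v x| <= N.
  move: x0L; rewrite !in_itv/= => /andP[x00 x0L] /andP[x0' xL].
  rewrite -[v x]subr0 -vx0; have [xx0|x0x] := leP x x0.
    by rewrite distrC; apply: antiderivative_dist_le vr ari _ _ _ _ _ _.
  by apply: antiderivative_dist_le vr ari _ _ _ _ _ _ => //; exact: ltW.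
have V_ub : V <= N ^+ 2 * L.
  rewrite -Icst; apply: le_Rintegral => //; first exact: integrable_cst_itv.
  move=> x xL.
  have := v_ub x xL; have := normr_ge0 (v x).
  rewrite -expr2 -(real_normK (num_real (v x))) => v0 vN.
  by rewrite ler_pXn2r ?nnegrE ?(le_trans v0).
have cmV : c = m + V / L.
  by apply: (mulIf (lt0r_neq0 L0)); rewrite mulrDl divfK ?lt0r_neq0.
(* The chain is [V <= N^2 L <= - S L^2 <= (q - m^2) L^3], divided by [L]. *)
rewrite cmV; apply/andP; split; first by rewrite lerDl divr_ge0.
rewrite lerD2l ler_pdivrMr// (le_trans V_ub)// ler_pM2r//.
rewrite (le_trans N_ub)// expr2 -mulrA [leRHS]mulrC ler_pM2r//.
by rewrite mulrC.
Qed.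

End riccati.

(** * Translation invariance and periodicity almost everywhere *)

Section translation.
Context {R : realType}.
Local Notation mu := (@lebesgue_measure R).

Lemma measurable_translation (c : R) :
  measurable_fun [set: R] (fun x : R => x + c).
Proof.
apply: continuous_measurable_fun => x.
by apply: cvgD; [exact: cvg_id|exact: cvg_cst].
Qed.

(** The pushforward under a translation gives half-open intervals their length, which characterizes
    Lebesgue measure. *)
Lemma lebesgue_measure_translation (c : R) (A : set R) : measurable A ->
  mu ((fun x => x + c) @^-1` A) = mu A.
Proof.
move=> mA; have mt := measurable_translation c.
rewrite [RHS](@lebesgue_measure_unique _
  (@pushforward _ _ _ (measurableTypeR R) _ mu (fun x : R => x + c)))//.
move=> _ [[a b] _ <-]; rewrite /= /pushforward.
have -> : (fun x => x + c) @^-1` `]a, b] = `]a - c, b - c]%classic.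
  by apply/seteqP; split=> x; rewrite /= !in_itv/= ltrBlDr lerBrDr.
rewrite !lebesgue_measure_itv/= !lte_fin ltrD2r; case: ifPn => // _.
by rewrite -!EFinD; congr EFin; lra.
Qed.

Lemma ae_translation (c : R) (P : R -> Prop) :
  {ae mu, forall x, P x} -> {ae mu, forall x, P (x + c)}.
Proof.
move=> [A [mA A0 PA]]; exists ((fun x => x + c) @^-1` A); split.
- by rewrite -[X in measurable X]setTI; apply: measurable_translation.
- by rewrite lebesgue_measure_translation.
- by move=> x; exact: PA.
Qed.

(** Periodicity holds only off a null set, so the exceptional sets of all integer translates are
    collected into one countable union. *)
Lemma ae_periodic_eq_cst (L s : R) (b : R -> R) : 0 < L ->
  {ae mu, forall x, b (x + L) = b x} ->
  {ae mu, forall x, `[0, L]%classic x -> b x = s} ->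
  {ae mu, forall x, b x = s}.
Proof.
move=> L0 bL bs; have F := ae_filter_ringOfSetsType mu.
have bnL (n : nat) : {ae mu, forall x, b (x + n%:R * L) = b x}.
  elim: n => [|n IH]; first by apply: nearW => x; rewrite mul0r addr0.
  have := ae_translation (n%:R * L) bL; apply: filterS2 IH => x /= <- <-.
  by congr b; rewrite -natr1; ring.
have up (n : nat) : {ae mu, forall x, `[0, L]%classic (x + n%:R * L) -> b x = s}.
  have := ae_translation (n%:R * L) bs; apply: filterS2 (bnL n) => x /= <-.
  exact.
have down (n : nat) : {ae mu, forall x, `[0, L]%classic (x - n%:R * L) -> b x = s}.
  have bnL' := ae_translation (- (n%:R * L)) (bnL n).
  have := ae_translation (- (n%:R * L)) bs; apply: filterS2 bnL' => x /=.
  by rewrite subrK => ->.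
have := ae_foralln down; apply: filterS2 (ae_foralln up) => x /= upx downx.
have [x0|x0] := leP 0 x.
  apply: (downx (Num.truncn (x / L))); rewrite /= in_itv/=.
  have /truncn_itv/andP[] : 0 <= x / L by rewrite divr_ge0// ltW.
  rewrite ler_pdivlMr// ltr_pdivrMr// mulrS mulrDl mul1r; lra.
(* For [x < 0] the successor is needed: with [n] the integer part of [- x / L], the point
   [x + (n + 1) L] lies in []0, L]]. *)
apply: (upx (Num.truncn (- x / L)).+1); rewrite /= in_itv/=.
have /truncn_itv/andP[] : 0 <= - x / L by rewrite divr_ge0 ?ltW// oppr_gt0.
rewrite ler_pdivlMr// ltr_pdivrMr// mulrS mulrDl mul1r; lra.
Qed.

End translation.

(** * From a positive eigenfunction to the Riccati equation *)

Section eigenvalue.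
Context {R : realType}.
Local Notation mu := (@lebesgue_measure R).

Lemma locally_integrable_itv (a b : R) (f : R -> R) :
  locally_integrable [set: R] f -> mu.-integrable `[a, b] (EFin \o f).
Proof.
move=> [mf _ fK]; apply/integrableP; split.
  by apply/measurable_EFinP; apply: measurable_funS mf.
by apply: fK => //; exact: segment_compact.
Qed.

Lemma has_L1loc_derivative_antiderivative (a b : R) (F f : R -> R) :
  has_L1loc_derivative F f -> antiderivative a b F f.
Proof.
move=> [fi Ff]; split; first exact: locally_integrable_itv.
by move=> x y _ xy _; exact: Ff.
Qed.

Lemma has_L1loc_derivative_continuous (F f : R -> R) :
  has_L1loc_derivative F f -> continuous F.
Proof.
move=> Ff x; have xx : x - 1 < x + 1 by lra.
have := antiderivative_continuous (ltW xx)
  (has_L1loc_derivative_antiderivative (x - 1) (x + 1) Ff).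
by move=> /(continuous_within_itvP _ xx)[+ _ _]; apply; rewrite in_itv/=; lra.
Qed.

(** The logarithmic derivative [v = psi' / psi] satisfies the Riccati equation with
    [c = - k - lambda^2], so [riccati_bounds] applies. *)
Lemma eigenvalue_bounds (L lambda k : R) (b psi : R -> R) : 0 < L ->
  let m := L^-1 * \int[mu]_(x in `[0, L]) b x in
  let q := L^-1 * \int[mu]_(x in `[0, L]) (b x ^+ 2) in
  mu.-integrable `[0, L] (EFin \o b) ->
  mu.-integrable `[0, L] (EFin \o (fun x => b x ^+ 2)) ->
  positive_periodic_solution L lambda b k psi ->
  m <= - k - lambda ^+ 2 <= m + L ^+ 2 * (q - m ^+ 2).
Proof.
move=> L0 m q bi b2i [psiL psi0 dpsi [psi2 [d2psi eqn]]].
pose dp := derive1 psi.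
have cdp : continuous dp := has_L1loc_derivative_continuous d2psi.
have isd (x : R) : is_derive x (1 : R) psi (dp x).
  by apply: DeriveDef => //; rewrite /dp derive1E.
have cpsi : continuous psi.
  by move=> x; apply: differentiable_continuous; apply/derivable1_diffP.
have psi_neq0 x : psi x != 0 by rewrite gt_eqF.
pose phi x := (psi x)^-1.
pose v x := dp x * phi x.
have cphi : continuous phi.
  by move=> x; apply: cvgV (cpsi x); exact: psi_neq0.
have cv : continuous v by move=> x; apply: cvgM; [exact: cdp|exact: cphi].
have dpL x : dp (x + L) = dp x.
  rewrite /dp /derive1.
  suff -> : (fun h => h^-1 *: (psi (h + (x + L)) - psi (x + L))) =
            (fun h => h^-1 *: (psi (h + x) - psi x)) by [].
  by apply/funext => h; rewrite addrA !psiL.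
have isdphi (x : R) : is_derive x (1 : R) phi (- (phi x * v x)).
  apply: is_derive_eq (is_deriveV (psi_neq0 x) (isd x)) _.
  rewrite /v /phi /GRing.scale/=; field.
  exact: psi_neq0.
have isln (x : R) : is_derive x (1 : R) (@ln R \o psi) (v x).
  rewrite /v mulrC.
  exact: is_derive1_comp (is_derive1_ln (psi0 x)) (isd x).
have lnv := derivable_antiderivative 0 L isln cv.
have phiv : antiderivative 0 L phi (fun x => - (phi x * v x)).
  apply: derivable_antiderivative => // x.
  by apply: cvgN; apply: cvgM; [exact: cphi|exact: cv].
(* As [psi'] is only absolutely continuous, [v] is handled as the product of [psi'] and [1 / psi] in
   integral form. *)
have vdp := antiderivativeM (ltW L0)
  (has_L1loc_derivative_antiderivative 0 L d2psi) phiv.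
have vL : v 0 = v L.
  by rewrite /v /phi -[L]add0r dpL psiL.
apply: (@riccati_bounds _ L lambda _ b v) => //.
(* Solving the eigenvalue equation for [psi2] and dividing by [psi] gives the Riccati right-hand
   side almost everywhere. *)
- apply: ae_eq_antiderivative vdp.
    apply: filterS eqn; first exact: (ae_filter_ringOfSetsType mu).
    move=> x /= eqx; rewrite -/dp in eqx.
    have -> : psi2 x = - 2 * lambda * dp x - (b x + lambda ^+ 2) * psi x - k * psi x.
      by lra.
    by rewrite /v /phi -/dp; field; exact: psi_neq0.
  have cint (g : R -> R) : continuous g -> mu.-integrable `[0, L] (EFin \o g).
    move=> cg; apply: continuous_compact_integrable; first exact: segment_compact.
    exact: continuous_subspaceT.
  have mI : measurable (`[0, L] : set R) by exact: measurable_itv.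
  apply: integrable_funB => //; last first.
    by apply: integrable_funZ => //; exact: cint.
  apply: integrable_funB => //.
    by apply: integrable_funB => //; exact: integrable_cst_itv.
  by apply: cint => x; apply: cvgM; exact: cv.
(* Mean zero: [v] is the derivative of [ln psi], which agrees at [0] and [L]. *)
- have [_ /(_ 0 L (lexx _) (ltW L0) (lexx _)) <-] := lnv.
  by rewrite /= -[L]add0r psiL subrr.
- have [x] : exists2 x : R, x \in `]0, L[ & is_derive x (1 : R) psi 0.
    apply: Rolle => //; first exact: continuous_subspaceT.
    by rewrite -[L]add0r psiL.
  rewrite in_itv/= => /andP[x0 xL] [_ dx].
  exists x; first by rewrite in_itv/= !ltW.
  by rewrite /v /dp derive1E dx mul0r.
Qed.

End eigenvalue.

(** * Minimal speeds and maximizers *)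

Section speed.
Context {R : realType}.
Local Notation mu := (@lebesgue_measure R).
Implicit Types (L lambda beta s : R) (b : R -> R).

Lemma locally_integrable_cst s : locally_integrable [set: R] (fun=> s).
Proof.
split; [exact: measurable_cst|exact: openT|move=> K _ cK].
have := @continuous_compact_integrable R (fun=> s) K cK.
by move=> /(_ (fun x => cvg_cst _))/integrableP[].
Qed.

(** The eigenfunction is 1. Uniqueness comes from [eigenvalue_bounds]: a constant has zero variance,
    so its two bounds coincide. *)
Lemma principal_eigenvalue_cst L lambda s : 0 < L ->
  principal_eigenvalue L lambda (fun=> s) = - (s + lambda ^+ 2).
Proof.
move=> L0; apply: xget_unique.
  exists (fun=> 1); split=> //.
  have -> : derive1 (fun _ : R => 1 : R) = (fun=> 0).
    by apply/funext => x; exact: derive1_cst.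
  exists (fun=> 0); split.
    split=> [|x y _]; first exact: locally_integrable_cst.
    by rewrite /Rintegral integral0_eq// subrr.
  by apply: nearW => x; ring.
move=> k [psi sol]; have Ln0 : L != 0 by rewrite gt_eqF.
have := eigenvalue_bounds L0 (integrable_cst_itv 0 L s)
  (integrable_cst_itv 0 L (s ^+ 2)) sol.
rewrite !Rintegral_itv_cst// mulrC mulfK// [L^-1 * (s ^+ 2 * L)]mulrC mulfK//.
by rewrite subrr mulr0 addr0 => /andP[? ?]; lra.
Qed.

(** The function to minimize is [s / l + l], with minimum at [l = sqrt s]. *)
Lemma minimal_speed_cst L s : 0 < L -> 0 < s ->
  minimal_speed L (fun=> s) = 2 * Num.sqrt s.
Proof.
move=> L0 s0; set r := Num.sqrt s; have r0 : 0 < r by rewrite sqrtr_gt0.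
have sE : s = r ^+ 2 by rewrite sqr_sqrtr// ltW.
have rE : 2 * r = - principal_eigenvalue L r (fun=> s) / r.
  by rewrite principal_eigenvalue_cst// opprK sE; field; rewrite gt_eqF.
have rmin l : 0 < l -> 2 * r <= - principal_eigenvalue L l (fun=> s) / l.
  move=> l0; rewrite principal_eigenvalue_cst// opprK ler_pdivlMr// sE.
  by have := sqr_ge0 (r - l); lra.
apply: xget_unique; first by split; [exists r|].
move=> c [[l l0 ->] lmin]; apply/eqP; rewrite eq_le rmin// andbT.
by rewrite rE lmin.
Qed.

(** Both [minimal_speed] and [principal_eigenvalue] default to 0, and a positive speed excludes both
    defaults. An eigenfunction is thus obtained without spectral theory. *)
Lemma solution_of_minimal_speed_gt0 L lambda b : 0 < lambda ->
  0 < minimal_speed L b ->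
  exists k psi, positive_periodic_solution L lambda b k psi /\
    minimal_speed L b <= - k / lambda.
Proof.
move=> l0; rewrite /minimal_speed.
case: xgetP => [c _ [_ /(_ _ l0) cmin] c0|]; last by rewrite ltxx.
have : principal_eigenvalue L lambda b != 0.
  apply/eqP => k0; move: cmin; rewrite k0 oppr0 mul0r => c0'.
  by have := lt_le_trans c0 c0'; rewrite ltxx.
rewrite /principal_eigenvalue in cmin *.
by case: xgetP cmin => [k _ [psi sol] cmin _|_ _]; [exists k, psi|rewrite eqxx].
Qed.

Lemma A2_cst L beta : 0 < L -> 0 < beta -> A2 L beta (fun=> Num.sqrt beta).
Proof.
move=> L0 beta0; split.
- exact: locally_integrable_cst.
- exact: nearW.
- by apply: nearW => x; exact: sqrtr_ge0.
- rewrite sqr_sqrtr ?ltW// integral_cst//.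
  rewrite /= lebesgue_measure_itv/= lte_fin L0 -EFinD -!EFinM subr0.
  by congr EFin; rewrite mulrC mulfK// gt_eqF.
Qed.

(** The constraint is an equality of extended reals with a finite value, so it already contains the
    integrability of [b^2]. *)
Lemma A2_integrable_sqr L beta b : 0 < L -> A2 L beta b ->
  mu.-integrable `[0, L] (EFin \o (fun x => b x ^+ 2)) /\
  L^-1 * \int[mu]_(x in `[0, L]) (b x ^+ 2) = beta.
Proof.
move=> L0 [[mb _ _] _ _ Ib].
have mb2 : measurable_fun `[0, L] (fun x => (b x ^+ 2)%:E).
  apply/measurable_EFinP/measurable_funX; exact: measurable_funS mb.
have I0 : (0 <= \int[mu]_(x in `[0%R, L]) (b x ^+ 2)%:E)%E.
  by apply: integral_ge0 => x _; rewrite lee_fin sqr_ge0.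
have Lbeta : (\int[mu]_(x in `[0%R, L]) (b x ^+ 2)%:E = (L * beta)%:E)%E.
  by rewrite EFinM -Ib muleA -EFinM divff ?gt_eqF// mul1e.
split.
  apply/integrableP; split => //.
  under eq_integral do rewrite /= ger0_norm ?sqr_ge0//.
  by rewrite Lbeta ltry.
by rewrite /Rintegral Lbeta/= mulrA mulVf ?mul1r// gt_eqF.
Qed.

Lemma maximizer_ae_cst L beta b : 0 < L -> 0 < beta ->
  2 * L ^+ 2 * Num.sqrt beta < 1 -> maximizes_speed L beta b ->
  {ae mu, forall x, b x = Num.sqrt beta}.
Proof.
move=> L0 beta0 betaL [bA2 bmax]; set s := Num.sqrt beta in betaL *.
have s0 : 0 < s by rewrite sqrtr_gt0.
have betaE : beta = s ^+ 2 by rewrite sqr_sqrtr// ltW.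
have [b2i qE] := A2_integrable_sqr L0 bA2.
have [lb bL _ _] := bA2.
have bi := locally_integrable_itv 0 L lb.
(* The parameter [lambda = r] is where the constant [s] attains its minimal speed [2 r]. *)
set r := Num.sqrt s; have r0 : 0 < r by rewrite sqrtr_gt0.
have sE : s = r ^+ 2 by rewrite sqr_sqrtr// ltW.
have cmin : 2 * r <= minimal_speed L b.
  by rewrite -(minimal_speed_cst L0 s0); apply: bmax; exact: A2_cst.
have [|k [psi [sol ck]]] := @solution_of_minimal_speed_gt0 L r b r0.
  by apply: lt_le_trans cmin; rewrite mulr_gt0.
have := eigenvalue_bounds L0 bi b2i sol; rewrite qE.
set m := L^-1 * _ => /andP[_ k_ub].
have k_lb : 2 * s <= - k.
  have := le_trans cmin ck; rewrite ler_pdivlMr// sE.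
  by rewrite -mulrA -expr2.
have IE : \int[mu]_(x in `[0, L]) b x = m * L.
  by rewrite /m mulrC mulrA divff ?mul1r// gt_eqF.
have IE2 : \int[mu]_(x in `[0, L]) (b x ^+ 2) = s ^+ 2 * L.
  by rewrite -betaE -qE mulrC mulrA divff ?mul1r// gt_eqF.
have mI : measurable (`[0, L] : set R) by exact: measurable_itv.
have wE : (fun x => (b x - m) ^+ 2) = (fun x => b x ^+ 2 - 2 * m * b x + m ^+ 2).
  by apply/funext => x; ring.
have i1 := integrable_funZ (2 * m) mI bi.
have i2 := integrable_funB mI b2i i1.
have ci := integrable_cst_itv 0 L (m ^+ 2).
have wi : mu.-integrable `[0, L] (EFin \o (fun x => (b x - m) ^+ 2)).
  by rewrite wE; exact: integrable_funD.
have Iw : \int[mu]_(x in `[0, L]) (b x - m) ^+ 2 = (s ^+ 2 - m ^+ 2) * L.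
  rewrite wE RintegralD// RintegralB// RintegralZl// IE IE2 Rintegral_itv_cst//.
  ring.
have sm : m ^+ 2 <= s ^+ 2.
  have : 0 <= \int[mu]_(x in `[0, L]) (b x - m) ^+ 2.
    by apply: Rintegral_ge0 => x _; exact: sqr_ge0.
  by rewrite Iw pmulr_lge0// subr_ge0.
have mE : m = s.
  move: k_ub; rewrite betaE => k_ub.
  have m_le : m <= s by nra.
  apply/eqP; rewrite eq_le m_le leNgt; apply/negP => ms.
  (* From [k_lb], [k_ub] and [r^2 = s] one has [s <= m + L^2 (s^2 - m^2)]. Dividing by [s - m > 0]
     gives [1 <= L^2 (s + m) < 2 L^2 s], against [betaL]. *)
  have : (s - m) * 1 <= (s - m) * (L ^+ 2 * (s + m)) by lra.
  rewrite ler_pM2l ?subr_gt0//.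
  have := exprn_gt0 2 L0; nra.
apply: (@ae_periodic_eq_cst _ L s b L0 bL).
move: Iw; rewrite mE subrr mul0r => Iw0.
rewrite mE in wi.
(* With [m = s] the variance of [b] vanishes, which forces [b = s] almost everywhere on one
   period. *)
have absI0 : (\int[mu]_(x in `[0%R, L]) `|((b x - s) ^+ 2)%:E| = 0)%E.
  under eq_integral do rewrite /= ger0_norm ?sqr_ge0//.
  rewrite -[LHS]fineK; last exact: integrable_fin_num wi.
  by congr EFin.
have [/(_ absI0) bs _] :=
  @ae_eq_integral_abs _ _ _ mu `[0, L]%classic mI _ (measurable_int mu wi).
have {}bs : {ae mu, forall x, `[0, L]%classic x -> ((b x - s) ^+ 2)%:E = 0%E}.
  exact: bs.
apply: filterS bs; first exact: (ae_filter_ringOfSetsType mu).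
move=> x /= bx /bx [] /eqP; rewrite sqrf_eq0 subr_eq0 => /eqP.
exact.
Qed.

(** The zero function is an admissible representative in the infimum. *)
Lemma C2norm_ae0 (f : R -> R) : {ae mu, forall x, f x = 0} -> (C2norm f <= 0)%E.
Proof.
move=> f0; apply: ereal_inf_lbound => /=.
have d0 : derive1 (cst 0 : R -> R) = cst 0.
  by apply/funext => x; exact: derive1_cst.
exists (cst 0).
  split=> //; split=> [x|x|]; [exact: derivable_cst|rewrite d0; exact: derivable_cst|].
  by rewrite /derive1n/= !d0 => x; exact: cvg_cst.
rewrite /derive1n/= !d0.
have -> : EFin \o (cst 0 : R -> R) = cst 0%E by [].
by rewrite Lnorm0// !adde0.
Qed.

End speed.

Theorem theorem2p10 (R : realType) (L : R) (hL : 0 < L) (b : R -> R -> R)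
    (hb : forall beta : R, 0 < beta -> maximizes_speed L beta (b beta)) :
  forall k : nat, exists C : R, \forall beta \near 0^'+,
    (C2norm (fun x => b beta x - Num.sqrt beta)%R <= (C * beta ^+ k)%:E)%E.
Proof.
(* The constant 0 serves for every [k], since the maximizer is exactly [sqrt beta] once [beta] is
   below the threshold. *)
move=> k; exists 0.
have d0 : 0 < (2 * L ^+ 2)^-1 by rewrite invr_gt0 mulr_gt0// exprn_gt0.
near=> beta.
have beta0 : 0 < beta by near: beta; exact: nbhs_right_gt.
have betaL : beta < (2 * L ^+ 2)^-1 ^+ 2.
  by near: beta; apply: nbhs_right_lt; rewrite exprn_gt0.
rewrite mul0r; apply: C2norm_ae0.
have betaL1 : 2 * L ^+ 2 * Num.sqrt beta < 1.
  rewrite mulrC -ltr_pdivlMr ?mulr_gt0 ?exprn_gt0// div1r.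
  by rewrite -[ltRHS]ger0_norm ?ltW// -sqrtr_sqr ltr_sqrt// exprn_gt0.
have := @maximizer_ae_cst _ L beta (b beta) hL beta0 betaL1 (hb beta beta0).
apply: filterS; first exact: (ae_filter_ringOfSetsType lebesgue_measure).
by move=> x /= ->; rewrite subrr.
Unshelve. all: by end_near. Qed.
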